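(* Let $p,p'$ be coprime integers with $0<p<p'$, and let $a,b,c,L$ be integers with $1\le a,b,c\le p'-1$, $c=b\pm1$, $L\ge0$ and $L+a-b$ even. Put $N=\frac{L-a+b}{2}$, $M=\frac{L+a-b}{2}$ and $r=\lfloor pc/p'\rfloor+\frac{b-c+1}{2}$. Then the map $h\mapsto\mu(h)$ described in the context is a bijection from the set of paths $\mathcal P^{p,p'}_{a,b,c}(L)$ onto the set $\mathcal H_{p',a}(N,M;p-r,r)$ of partitions with prescribed hook differences, and it preserves weights: $wt(h)$ equals the sum of the parts of $\mu(h)$ for every $h\in\mathcal P^{p,p'}_{a,b,c}(L)$.
   Context: Paths. $\mathcal P^{p,p'}_{a,b,c}(L)$ is the set of integer sequences $h=(h_0,\dots,h_L)$ with $1\le h_i\le p'-1$, $|h_{i+1}-h_i|=1$, $h_0=a$, $h_L=b$. Put $h_{L+1}=c$. The band between heights $k$ and $k+1$ ($1\le k\le p'-2$) is even if $\lfloor kp/p'\rfloor=\lfloor (k+1)p/p'\rfloor$ and odd otherwise. For $1\le i\le L$ the vertex $v_i$ is formed by the segment from $(i-1,h_{i-1})$ to $(i,h_i)$ and the segment from $(i,h_i)$ to $(i+1,h_{i+1})$; its parity is that of the band between $h_i$ and $h_{i+1}$; it is straight if $h_{i-1}\ne h_{i+1}$ and a peak if $h_{i-1}=h_{i+1}$. A vertex is scoring if it is straight and odd, or a peak and even; otherwise it is non-scoring. With $x_i=\frac{i-(h_i-a)}2$, $y_i=\frac{i+(h_i-a)}2$, set $c_i=x_i$ if $v_i$ is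 scoring and $h_i=h_{i-1}+1$, $c_i=y_i$ if $v_i$ is scoring and $h_i=h_{i-1}-1$, and $c_i=0$ if $v_i$ is non-scoring. The weight is $wt(h)=\sum_{i=1}^L c_i$. The map. Start with the empty partition and counters $N=M=0$, and process $v_1,\dots,v_L$ in order. If $h_i=h_{i-1}+1$: when $v_i$ is scoring, add a new first column of length (the current) $M$ to the Young diagram (i.e. add 1 to each of the first $M$ parts, including zero parts), and when $v_i$ is non-scoring leave the partition unchanged; in both cases then increment $N$ by 1. If $h_i=h_{i-1}-1$: when $v_i$ is scoring, add a new first row (part) equal to the current $N$, and when $v_i$ is non-scoring leave the partition unchanged; in both cases then increment $M$ by 1. The resulting partition is $\mu(h)$. Hook differences. For a partition $\mu=(\mu_1\ge\mu_2\ge\cdots)$ with conjugate $\mu'$, the hook difference at the cell $(i,j)$ of the Young diagram ($i$ = row, $j$ = column) is $\mu_i-\mu'_j$; the cell lies on diagonal $k$ if $i-j=k$. For non-negative integers, $\mathcal H_{K,i}(N,M;\alpha,\beta)$ is the set of partitions $\mu$ with at most $M$ parts, each at most $N$, such that all hook differences on diagonal $1-\beta$ are at least $\beta-i+1$ and all hook differences on diagonal $\alpha-1$ are at most $K-i-\alpha-1$; moreover, if $\alpha=0$ it is also required that $\mu_{N-K+i+1}>0$ (a vacuous condition if the index is $\le0$), and if $\beta=0$ it is also required that $\mu_1>M-i$. *)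

(* Defs.v *)
From mathcomp Require Import all_boot all_order all_algebra.
From mathcomp Require Import boolp classical_sets functions.

Set Implicit Arguments.
Unset Strict Implicit.
Unset Printing Implicit Defensive.

Import Order.TTheory GRing.Theory Num.Theory.
Local Open Scope classical_set_scope.
Local Open Scope ring_scope.

(** * Paths *)

(* A path (h_0, ..., h_L) is stored as the sequence of its L + 1 heights. *)
Definition paths (p' a b : int) (L : nat) : set (seq int) :=
  [set h | [/\ size h = L.+1,
               forall i : nat, (i <= L)%N -> 1 <= h`_i <= p' - 1,
               forall i : nat, (i < L)%N -> `|h`_i.+1 - h`_i| = 1,
               h`_0 = a
             & h`_L = b]].

(* h_i for 0 <= i <= L + 1, with the convention h_{L+1} = c. *)
Definition height (c : int) (h : seq int) (i : nat) : int := (rcons h c)`_i.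

(* The band between heights k and k + 1; as p' > 0, %/ is the floor here. *)
Definition even_band (p p' k : int) : bool :=
  ((k * p) %/ p')%Z == (((k + 1) * p) %/ p')%Z.

(* Parity, shape, type and weight of the vertex v_i, where i >= 1. *)

Definition even_vertex (p p' c : int) (h : seq int) (i : nat) : bool :=
  even_band p p' (Num.min (height c h i) (height c h i.+1)).

Definition straight (c : int) (h : seq int) (i : nat) : bool :=
  height c h i.-1 != height c h i.+1.

Definition peak (c : int) (h : seq int) (i : nat) : bool :=
  height c h i.-1 == height c h i.+1.

Definition scoring (p p' c : int) (h : seq int) (i : nat) : bool :=
  straight c h i && ~~ even_vertex p p' c h i
  || peak c h i && even_vertex p p' c h i.

Definition up_step (c : int) (h : seq int) (i : nat) : bool :=
  height c h i == height c h i.-1 + 1.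

(* On a path starting at a both divisions by 2 are exact. *)
Definition x_coord (a c : int) (h : seq int) (i : nat) : int :=
  ((i%:Z - (height c h i - a)) %/ 2)%Z.

Definition y_coord (a c : int) (h : seq int) (i : nat) : int :=
  ((i%:Z + (height c h i - a)) %/ 2)%Z.

Definition vertex_weight (p p' a c : int) (h : seq int) (i : nat) : int :=
  if scoring p p' c h i then
    if up_step c h i then x_coord a c h i else y_coord a c h i
  else 0.

Definition wt (p p' a c : int) (L : nat) (h : seq int) : int :=
  \sum_(1 <= i < L.+1) vertex_weight p p' a c h i.

(** * Partitions *)

(* A partition is the nonincreasing sequence of its positive parts. *)
Definition is_partition (mu : seq nat) : bool :=
  sorted geq mu && (0%N \notin mu).

(* mu_i, with rows counted from 1, and mu_i = 0 past the last part. *)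
Definition part (mu : seq nat) (i : nat) : nat := nth 0%N mu i.-1.

(* mu'_j, with columns counted from 1. *)
Definition conj_part (mu : seq nat) (j : nat) : nat :=
  count (fun x => (j <= x)%N) mu.

Definition in_diagram (mu : seq nat) (i j : nat) : bool :=
  [&& (1 <= i)%N, (1 <= j)%N & (j <= part mu i)%N].

Definition hook_diff (mu : seq nat) (i j : nat) : int :=
  (part mu i)%:Z - (conj_part mu j)%:Z.

(* The set H_{K,i}(N,M;alpha,beta); it is empty if N < 0 or M < 0. *)
Definition hook_partitions (K i N M alpha beta : int) : set (seq nat) :=
  [set mu |
    [/\ is_partition mu,
        0 <= N /\ 0 <= M,
        (size mu)%:Z <= M /\ (forall x : nat, x \in mu -> x%:Z <= N),
        (forall s t : nat, in_diagram mu s t -> s%:Z - t%:Z = 1 - beta ->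
           beta - i + 1 <= hook_diff mu s t) /\
        (forall s t : nat, in_diagram mu s t -> s%:Z - t%:Z = alpha - 1 ->
           hook_diff mu s t <= K - i - alpha - 1)
      & (alpha = 0 -> 0 < N - K + i + 1 ->
           (0 < part mu `|(N - K + i + 1)%R|)%N) /\
        (beta = 0 -> M - i < (part mu 1)%:Z)]].

(** * The map from paths to partitions *)

Definition add_column (M : nat) (mu : seq nat) : seq nat :=
  [seq (part mu k).+1 | k <- iota 1 M] ++ drop M mu.

(* A new part equal to 0 is not recorded, as only positive parts are stored. *)
Definition add_row (N : nat) (mu : seq nat) : seq nat :=
  if N == 0%N then mu else N :: mu.

Record state := State {
  st_part : seq nat;
  st_N : nat;
  st_M : nat
}.

Definition process_vertex (p p' c : int) (h : seq int) (s : state) (i : nat) :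
    state :=
  let: State mu N M := s in
  if up_step c h i then
    State (if scoring p p' c h i then add_column M mu else mu) N.+1 M
  else
    State (if scoring p p' c h i then add_row N mu else mu) N M.+1.

Definition path_partition (p p' c : int) (L : nat) (h : seq int) : seq nat :=
  st_part (foldl (process_vertex p p' c h) (State [::] 0 0) (iota 1 L)).

(* Main.v *)
Require Import Defs.
From mathcomp Require Import all_boot all_order all_algebra.
From mathcomp Require Import boolp classical_sets functions.
From mathcomp Require Import zify.

Set Implicit Arguments.
Unset Strict Implicit.
Unset Printing Implicit Defensive.

Import Order.TTheory GRing.Theory Num.Theory.
Local Open Scope classical_set_scope.
Local Open Scope ring_scope.

(** The bijection is proved by induction on [L], removing the last step of a
    path.  With [f = floor (p b / p')], the index [r] attached to the last two
    heights [(b, c)] is [f] or [f + 1]; it is [f] for the heights [(b - 1, b)]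
    and [f + 1] for [(b + 1, b)].  The last vertex is scoring exactly when this
    index changes.  If [r = f], an up step does nothing and a down step adds a
    first row [N], so that the shorter paths account for the partitions with
    [mu_1 < N] and with [mu_1 = N].  If [r = f + 1], an up step adds a first
    column [M] and a down step does nothing, so that they account for the
    partitions with exactly [M] and with fewer than [M] parts.  At the walls
    [b = 0] and [b = p'] the conditions for [beta = 0] and [alpha = 0] force
    the set of partitions to be empty, so that no case distinction on [b] is
    needed in the recursion. *)

(** * Adding and removing a first column *)

Lemma add_columnE (M : nat) (mu : seq nat) : (size mu <= M)%N ->
  add_column M mu = map succn (mu ++ nseq (M - size mu) 0%N).
Proof.
move=> le_mu; rewrite /add_column drop_oversize // cats0.
apply: (@eq_from_nth _ 0%N) => [|i].
  by rewrite !size_map size_iota size_cat size_nseq subnKC.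
rewrite size_map size_iota => lt_iM.
rewrite (nth_map 0%N) ?size_iota // nth_iota // (nth_map 0%N); last first.
  by rewrite size_cat size_nseq subnKC.
rewrite /part add1n /= nth_cat; case: ltnP => // le_mu_i.
by rewrite nth_default // nth_nseq if_same.
Qed.

Lemma size_add_column (M : nat) (mu : seq nat) : (size mu <= M)%N ->
  size (add_column M mu) = M.
Proof.
by move=> le_mu; rewrite add_columnE // size_map size_cat size_nseq subnKC.
Qed.

Lemma sumn_add_column (M : nat) (mu : seq nat) : (size mu <= M)%N ->
  sumn (add_column M mu) = (M + sumn mu)%N.
Proof.
move=> le_mu; rewrite add_columnE //.
have sumn_succ (s : seq nat) : sumn (map succn s) = (size s + sumn s)%N.
  by elim: s => //= x s ->; lia.
by rewrite sumn_succ sumn_cat sumn_nseq mul0n addn0 size_cat size_nseq subnKC.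
Qed.

Lemma part_add_column (M : nat) (mu : seq nat) (s : nat) :
  (size mu <= M)%N -> (1 <= s <= M)%N ->
  part (add_column M mu) s = (part mu s).+1.
Proof.
move=> le_mu; case: s => // s /= lt_sM.
rewrite /part /= add_columnE // (nth_map 0%N); last first.
  by rewrite size_cat size_nseq subnKC.
rewrite nth_cat; case: ltnP => // le_mu_s.
by rewrite nth_nseq if_same nth_default.
Qed.

Lemma conj_part_add_column (M : nat) (mu : seq nat) (t : nat) :
  (size mu <= M)%N -> (1 <= t)%N ->
  conj_part (add_column M mu) t.+1 = conj_part mu t.
Proof.
move=> le_mu; case: t => // t _; rewrite /conj_part add_columnE //.
by rewrite count_map count_cat count_nseq /= mul0n addn0.
Qed.

Lemma conj_part1_add_column (M : nat) (mu : seq nat) : (size mu <= M)%N ->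
  conj_part (add_column M mu) 1 = M.
Proof.
move=> le_mu; rewrite -[RHS](size_add_column le_mu); apply/eqP.
by rewrite -all_count add_columnE // all_map; apply/allP.
Qed.

(** The filter discards the parts equal to 1, which would become zero parts. It also discards the
    padding of [add_column], so one function undoes [add_column M] for every [M]. *)
Definition remove_column (mu : seq nat) : seq nat :=
  [seq x <- map predn mu | (0 < x)%N].

Lemma size_remove_column (mu : seq nat) :
  (size (remove_column mu) <= size mu)%N.
Proof. by rewrite size_filter (leq_trans (count_size _ _)) ?size_map. Qed.

Lemma add_columnK (M : nat) (mu : seq nat) :
  (size mu <= M)%N -> 0%N \notin mu -> remove_column (add_column M mu) = mu.
Proof.
move=> le_mu mu0; rewrite /remove_column add_columnE // -map_comp.
rewrite (eq_map (g := id)) // map_id filter_cat filter_nseq /= cats0.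
by apply/all_filterP/allP => -[|x] //; rewrite (negPf mu0).
Qed.

Lemma geq_trans : transitive geq.
Proof. by move=> y x z /= xy yz; apply: leq_trans xy. Qed.

Lemma is_partition_remove_column (mu : seq nat) :
  is_partition mu -> is_partition (remove_column mu).
Proof.
case/andP=> s_mu _; rewrite /is_partition mem_filter /= andbT.
apply: sorted_filter; first exact: geq_trans.
by apply: homo_sorted s_mu => x y /= ?; lia.
Qed.

Lemma is_partition_add_column (M : nat) (mu : seq nat) :
  (size mu <= M)%N -> is_partition mu -> is_partition (add_column M mu).
Proof.
move=> le_mu /andP[s_mu mu0]; rewrite /is_partition add_columnE //.
apply/andP; split; last by apply/negP => /mapP[].
apply: (homo_sorted (e := geq)) => //.
rewrite sorted_pairwise ?pairwise_cat; last exact: geq_trans.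
rewrite -sorted_pairwise ?s_mu /=; last exact: geq_trans.
rewrite -sorted_pairwise; last exact: geq_trans.
apply/andP; split; last by elim: (M - _)%N => //= -[|n].
by apply/allrelP => x y _; rewrite mem_nseq => /andP[_ /eqP->].
Qed.

(** In a nonincreasing sequence the zeros stand at the end, so dropping them loses only their
    number. This is what makes [remove_column] reversible. *)
Lemma sorted_geq_split0 (s : seq nat) : sorted geq s ->
  s = [seq x <- s | (0 < x)%N] ++ nseq (count_mem 0%N s) 0%N.
Proof.
elim: s => //= -[|x] s IHs; last by move=> /path_sorted/IHs {1}->.
rewrite /= path_sortedE; last exact: geq_trans.
case/andP=> /allP s0 _.
have -> : s = nseq (size s) 0%N.
  by apply/all_pred1P/allP => y /s0; rewrite /geq /= leqn0.
by rewrite filter_nseq /= count_nseq /= mul1n.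
Qed.

Lemma remove_columnK (mu : seq nat) : is_partition mu ->
  add_column (size mu) (remove_column mu) = mu.
Proof.
case/andP=> s_mu mu0; have le_mu := size_remove_column mu.
have s_mu' : sorted geq (map predn mu).
  by apply: homo_sorted s_mu => x y /= ?; lia.
rewrite add_columnE //.
(* Comparing sizes shows that the padding put back by [add_column (size mu)] consists of exactly as
   many zeros as the filter removed. *)
have /(congr1 size) := sorted_geq_split0 s_mu'.
rewrite size_map size_cat size_nseq -/(remove_column mu) => ->.
rewrite addKn -sorted_geq_split0 // -map_comp -[RHS]map_id.
apply/eq_in_map => -[|x] // mu_0; by rewrite mu_0 in mu0.
Qed.

(** * Parts, cells and hook differences *)

Lemma part_le_part1 (mu : seq nat) (x : nat) :
  is_partition mu -> x \in mu -> (x <= part mu 1)%N.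
Proof.
case/andP; case: mu => //= y s; rewrite path_sortedE; last exact: geq_trans.
by case/andP=> /allP s_y _ _; rewrite inE /part /= => /predU1P[->|/s_y].
Qed.

Lemma mem_part (mu : seq nat) (s : nat) :
  (1 <= part mu s)%N -> part mu s \in mu.
Proof.
case: (ltnP s.-1 (size mu)) => [/mem_nth|/(nth_default 0%N)];
  by rewrite /part => ->.
Qed.

Lemma is_partition_cons (N : nat) (mu : seq nat) :
  is_partition (N :: mu)
  = [&& (0 < N)%N, all (fun x => (x <= N)%N) mu & is_partition mu].
Proof.
rewrite /is_partition inE negb_or /= path_sortedE; last exact: geq_trans.
rewrite [0%N == N]eq_sym -lt0n.
by case: (0 < N)%N; rewrite ?andbF ?andbT //= -andbA.
Qed.

Lemma conj_part1 (mu : seq nat) : 0%N \notin mu -> conj_part mu 1 = size mu.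
Proof.
move=> mu0; apply/eqP; rewrite -all_count; apply/allP => x mu_x.
by rewrite lt0n; apply: contraNneq mu0 => <-.
Qed.

Lemma conj_part_le_size (mu : seq nat) (t : nat) :
  (conj_part mu t <= size mu)%N.
Proof. exact: count_size. Qed.

Lemma part_gt0 (mu : seq nat) (s : nat) :
  0%N \notin mu -> (1 <= s <= size mu)%N -> (0 < part mu s)%N.
Proof.
move=> mu0; case: s => // s /= lt_s; rewrite lt0n.
by apply: contraNneq mu0 => <-; apply: mem_nth.
Qed.

Lemma in_diagram_le_size (mu : seq nat) (s t : nat) :
  in_diagram mu s t -> (s <= size mu)%N.
Proof.
case: s => // s /and3P[_ t1]; rewrite /part /=.
by case: ltnP => // /(nth_default 0%N) ->; case: t t1.
Qed.

Lemma in_diagram_mem (mu : seq nat) (s t : nat) :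
  in_diagram mu s t -> part mu s \in mu /\ (t <= part mu s)%N.
Proof.
by case/and3P=> _ t1 le_t; split=> //; apply/mem_part/(leq_trans t1).
Qed.

(** A new first row moves each old cell down by one and lengthens its column by one, so [s - t]
    rises by 1 and the hook difference drops by 1. Passing from [(alpha - 1, beta + 1)] to
    [(alpha, beta)] shifts both diagonals and both bounds by the same amounts. *)
Lemma hook_diff_cons (N : nat) (mu : seq nat) (s t : nat) :
  (1 <= s)%N -> (t <= N)%N ->
  hook_diff (N :: mu) s.+1 t = hook_diff mu s t - 1.
Proof.
by case: s => // s _; rewrite /hook_diff /conj_part /part /= => ->; lia.
Qed.

Lemma hook_diff_cons1 (N : nat) (mu : seq nat) (t : nat) :
  (t <= N)%N -> hook_diff (N :: mu) 1 t = N%:Z - 1 - (conj_part mu t)%:Z.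
Proof. by rewrite /hook_diff /conj_part /part /= => ->; lia. Qed.

(** The transposed effect: [s - t] drops by 1 and the hook difference rises by 1, in agreement with
    the passage from [(alpha + 1, beta - 1)] to [(alpha, beta)]. *)
Lemma hook_diff_add_column (M : nat) (mu : seq nat) (s t : nat) :
  (size mu <= M)%N -> (1 <= s <= M)%N -> (1 <= t)%N ->
  hook_diff (add_column M mu) s t.+1 = hook_diff mu s t + 1.
Proof.
move=> le_mu s_le t1.
by rewrite /hook_diff part_add_column // conj_part_add_column //; lia.
Qed.

Lemma hook_diff_add_column1 (M : nat) (mu : seq nat) (s : nat) :
  (size mu <= M)%N -> (1 <= s <= M)%N ->
  hook_diff (add_column M mu) s 1 = (part mu s)%:Z + 1 - M%:Z.
Proof.
move=> le_mu s_le.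
by rewrite /hook_diff part_add_column // conj_part1_add_column //; lia.
Qed.

Lemma partition_le0 (mu : seq nat) :
  is_partition mu -> (forall x, x \in mu -> (x <= 0)%N) -> mu = [::].
Proof.
case: mu => // x s /andP[_ /negP mu0] le0.
have := le0 x (mem_head x s); rewrite leqn0 => /eqP x0.
by rewrite x0 mem_head in mu0.
Qed.

(** * Removing a first row or column within the sets of partitions *)

Lemma nil_hook_partitions (K i N M alpha beta : int) :
  0 <= N -> 0 <= M -> (alpha = 0 -> N - K + i + 1 <= 0) ->
  (beta = 0 -> M - i < 0) ->
  hook_partitions K i N M alpha beta [::].
Proof.
move=> N0 M0 a0 b0; split=> //; split=> //.
- by move=> s t /and3P[_]; rewrite /part nth_nil; case: t.
- by move=> s t /and3P[_]; rewrite /part nth_nil; case: t.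
- by move=> /a0; lia.
Qed.

(** Besides the size bounds, [N] enters only the condition for [alpha = 0], which is vacuous
    here. *)
Lemma hook_partitions_widen_N (K i N M alpha beta : int) (mu : seq nat) :
  alpha != 0 -> hook_partitions K i (N - 1) M alpha beta mu ->
  hook_partitions K i N M alpha beta mu.
Proof.
move=> a0 [pmu [N0 M0] [sz le] hk [_ ?]]; split=> //; first lia.
  by split=> // x /le; lia.
by split=> // a_eq; rewrite a_eq in a0.
Qed.

Lemma hook_partitions_widen_M (K i N M alpha beta : int) (mu : seq nat) :
  beta != 0 -> hook_partitions K i N (M - 1) alpha beta mu ->
  hook_partitions K i N M alpha beta mu.
Proof.
move=> a0 [pmu [N0 M0] [sz le] hk [? _]]; split=> //; first lia.
  by split=> //; lia.
by split=> // a_eq; rewrite a_eq in a0.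
Qed.

(** Old cells are settled by [hook_diff_cons]; only the new first row needs an argument. On diagonal
    [1 - beta] the bound on [beta] suffices, since columns of [mu] have length at most [M - 1].
    Diagonal [alpha - 1] meets the first row only for [alpha = 1], at the corner. *)
Lemma add_row_hook_partitions (K i M alpha beta : int) (N : nat)
    (mu : seq nat) :
  i < K -> 0 < alpha -> 0 <= beta < N%:Z - M + i ->
  hook_partitions K i N (M - 1) (alpha - 1) (beta + 1) mu ->
  hook_partitions K i N M alpha beta (add_row N mu).
Proof.
move=> ltiK a0 b0 [pmu [N0 M0] [sz le] [lo hi] [ha hb]].
have mu0 : 0%N \notin mu by case/andP: pmu.
rewrite /add_row; case: eqP => [N_eq0|/eqP N_neq0].
  rewrite (partition_le0 pmu) => [|x /le]; last by lia.
  by apply: nil_hook_partitions; lia.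
have N_gt0 : (0 < N)%N by rewrite lt0n.
split.
- rewrite is_partition_cons N_gt0 pmu andbT.
  by apply/allP => x /le; lia.
- by lia.
- split=> [/=|x]; first lia.
  by rewrite inE => /predU1P[->|/le].
- split=> -[|[|s]] // t /and3P[_ t1]; rewrite /part /= => le_t diag.
  + rewrite hook_diff_cons1 //.
    by have := conj_part_le_size mu t; lia.
  + have dg : in_diagram mu s.+1 t by apply/and3P.
    have /le le_N : nth 0%N mu s \in mu by case: (in_diagram_mem dg).
    rewrite hook_diff_cons //; last by lia.
    by have := lo _ _ dg; lia.
  + have -> : t = 1%N by lia.
    rewrite hook_diff_cons1 // conj_part1 //.
    (* The corner bound says that [mu] has at least [N - K + i + 1] parts. This is the extra
       condition on [mu], whose first parameter [alpha - 1] is 0. *)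
    case: (lerP (N%:Z - K + i + 1) 0) => [|gt0]; first by lia.
    have /ha/(_ gt0)/mem_part : alpha - 1 = 0 by lia.
    rewrite /part => mem_mu.
    case: (ltnP (`|(N%:Z - K + i + 1)%R|.-1) (size mu)) => [|le_sz]; first lia.
    by rewrite nth_default // (negPf mu0) in mem_mu.
  + have dg : in_diagram mu s.+1 t by apply/and3P.
    have /le le_N : nth 0%N mu s \in mu by case: (in_diagram_mem dg).
    rewrite hook_diff_cons //; last by lia.
    by have := hi _ _ dg; lia.
- by split=> [?|b_eq]; rewrite /part /=; lia.
Qed.

(** The dichotomy is whether the largest part is below [N] or equal to [N]. For [N = 0] only the
    empty partition remains, and it counts as having a zero row added. *)
Lemma hook_partitions_row_cover (K i M alpha beta : int) (N : nat)
    (mu : seq nat) :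
  0 < N%:Z + M -> i < K -> 0 < alpha -> 0 <= beta ->
  hook_partitions K i N M alpha beta mu ->
  hook_partitions K i (N%:Z - 1) M alpha beta mu \/
  exists2 nu, hook_partitions K i N (M - 1) (alpha - 1) (beta + 1) nu
            & mu = add_row N nu.
Proof.
move=> NM_gt0 ltiK a0 b0 [pmu [N0 M0] [sz le] [lo hi] [ha hb]].
have mu0 : 0%N \notin mu by case/andP: pmu.
case: (posnP N) => [N_eq0|N_gt0].
  have mu_nil : mu = [::].
    by apply: partition_le0 => // x /le; lia.
  right; exists [::]; last by rewrite /add_row N_eq0 eqxx.
  by apply: nil_hook_partitions; lia.
case: (ltnP (part mu 1) N) => [lt_part|ge_part].
  left; split=> //; first lia.
    by split=> // x /(part_le_part1 pmu); lia.
  by split=> //; lia.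
right; case: mu => [|n mu] in pmu sz le lo hi ha hb mu0 ge_part *.
  by rewrite /part /= in ge_part; lia.
have {ge_part} n_eq : n = N.
  by have := le n (mem_head n mu); rewrite /part /= in ge_part; lia.
rewrite {}n_eq in pmu sz le lo hi ha hb mu0 *.
exists mu; last by rewrite /add_row gtn_eqF.
have := pmu; rewrite is_partition_cons => /and3P[_ /allP le_N pmu'].
have cell s t : in_diagram mu s t ->
    [/\ (1 <= s)%N, (t <= N)%N & in_diagram (N :: mu) s.+1 t].
  move=> dg; have [/le_N le_sN le_t] := in_diagram_mem dg.
  case/and3P: (dg) => s1 t1 _; split=> //; first exact: leq_trans le_sN.
  by case: s {le_sN le_t} s1 dg.
split=> //.
- by move: sz => /=; lia.
- by split=> [|x mu_x]; [move: sz => /=; lia|apply: le; rewrite inE mu_x orbT].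
- split=> s t /cell[s1 le_tN dg] diag.
    by have := lo _ _ dg; rewrite hook_diff_cons //; lia.
  by have := hi _ _ dg; rewrite hook_diff_cons //; lia.
- split=> [a1 gt0|]; last by lia.
  apply: part_gt0; first by move: mu0; rewrite inE negb_or => /andP[].
  (* For [alpha = 1] the corner lies on diagonal [alpha - 1]; its upper bound becomes the lower
     bound on the number of remaining parts. *)
  have dg : in_diagram (N :: mu) 1 1 by apply/and3P; split.
  have := hi _ _ dg; rewrite hook_diff_cons1 //.
  rewrite conj_part1; last by move: mu0; rewrite inE negb_or => /andP[].
  by lia.
Qed.

(** Now only the new first column matters. On diagonal [alpha - 1] the bound on [alpha] suffices, as
    parts of [mu] are at most [N - 1]. Diagonal [1 - beta] meets the column only for [beta = 1], at
    the corner, where the condition [M - i < mu_1] on [mu] is what is required. *)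
Lemma add_column_hook_partitions (K i N alpha beta : int) (M : nat)
    (mu : seq nat) :
  0 < i -> 0 < beta -> 0 <= alpha < K - i - N + M%:Z ->
  hook_partitions K i (N - 1) M (alpha + 1) (beta - 1) mu ->
  hook_partitions K i N M alpha beta (add_column M mu).
Proof.
move=> i_gt0 b0 a0 [pmu [N0 M0] [sz le] [lo hi] [ha hb]].
have mu0 : 0%N \notin mu by case/andP: pmu.
have {}sz : (size mu <= M)%N by lia.
have part_le s : (part mu s)%:Z <= N - 1.
  by case: (posnP (part mu s)) => [->|/mem_part/le].
have cell s t : in_diagram (add_column M mu) s t.+2 ->
    (1 <= s <= M)%N /\ in_diagram mu s t.+1.
  move=> dg; have := in_diagram_le_size dg; rewrite size_add_column // => le_s.
  case/and3P: dg => s1 _; rewrite part_add_column ?s1 // => le_t.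
  by split=> //; apply/and3P.
have cell1 s : in_diagram (add_column M mu) s 1 -> (1 <= s <= M)%N.
  move=> dg; have := in_diagram_le_size dg; rewrite size_add_column //.
  by case/and3P: dg => ->.
split.
- exact: is_partition_add_column.
- by lia.
- split=> [|x]; first by rewrite size_add_column.
  move=> /(nthP 0%N)[k]; rewrite size_add_column // => lt_k <-.
  have := part_add_column (s := k.+1) sz; rewrite lt_k /= {1}/part /= => -> //.
  by have := part_le k.+1; lia.
- split=> s [|[|t]] dg diag; try by case/and3P: dg.
  + have s_le := cell1 _ dg.
    rewrite hook_diff_add_column1 //.
    have s1 : s = 1%N by lia.
    by rewrite s1; have : beta - 1 = 0 by [lia]; move/hb; lia.
  + have [s_le dg'] := cell _ _ dg.
    rewrite hook_diff_add_column //.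
    by have := lo _ _ dg'; lia.
  + have s_le := cell1 _ dg.
    by rewrite hook_diff_add_column1 //; have := part_le s; lia.
  + have [s_le dg'] := cell _ _ dg.
    rewrite hook_diff_add_column //.
    by have := hi _ _ dg'; lia.
(* For [alpha = 0] the bound on [alpha] gives [N - K + i + 1 <= M], and the new partition has
   exactly [M] parts. *)
- split=> [a_eq gt0|b_eq]; last by lia.
  apply: part_gt0; last by rewrite size_add_column //; lia.
  by case/andP: (is_partition_add_column sz pmu).
Qed.

Lemma hook_partitions_column_cover (K i N alpha beta : int) (M : nat)
    (mu : seq nat) :
  0 < N + M%:Z -> 0 < i -> 0 < beta -> 0 <= alpha ->
  hook_partitions K i N M alpha beta mu ->
  hook_partitions K i N (M%:Z - 1) alpha beta mu \/
  exists2 nu, hook_partitions K i (N - 1) M (alpha + 1) (beta - 1) nu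
            & mu = add_column M nu.
Proof.
move=> NM_gt0 i_gt0 b0 a0 [pmu [N0 M0] [sz le] [lo hi] [ha hb]].
have mu0 : 0%N \notin mu by case/andP: pmu.
case: (ltnP (size mu) M) => [lt_sz|ge_sz].
  left; split=> //; first lia.
    by split=> //; lia.
  by split=> //; lia.
have {ge_sz sz} size_mu : size mu = M by lia.
right; have def_mu := remove_columnK pmu; rewrite size_mu in def_mu.
have := is_partition_remove_column pmu; have := size_remove_column mu.
rewrite size_mu; set nu := remove_column mu in def_mu * => sz pnu.
exists nu => //.
have nu0 : 0%N \notin nu by case/andP: pnu.
have cell s t : in_diagram nu s t ->
    [/\ (1 <= s <= M)%N, (1 <= t)%N & in_diagram mu s t.+1].
  move=> dg; have := leq_trans (in_diagram_le_size dg) sz => le_s.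
  case/and3P: dg => s1 t1 le_t; split=> //; first by rewrite s1.
  by apply/and3P; split=> //; rewrite -def_mu part_add_column ?s1.
have N_gt0 : 0 < N.
  case: (posnP M) => [|M_gt0]; first lia.
  have /mem_part/le : (1 <= part mu 1)%N by apply: part_gt0; rewrite ?size_mu.
  by have := part_gt0 (s := 1) mu0; rewrite size_mu M_gt0; lia.
split=> //.
- by lia.
- split=> // x /(nthP 0%N)[k lt_k <-].
  have lt_kM : (k < M)%N by apply: leq_trans sz.
  have := part_add_column (s := k.+1) sz; rewrite lt_kM def_mu => /(_ isT).
  rewrite [in RHS]/part /= => part_mu.
  by have /mem_part/le : (1 <= part mu k.+1)%N by [rewrite part_mu]; lia.
- split=> s t /cell[s_le t1 dg] diag.
    by have := lo _ _ dg; rewrite -def_mu hook_diff_add_column //; lia.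
  by have := hi _ _ dg; rewrite -def_mu hook_diff_add_column //; lia.
- split=> [|b1]; first by lia.
  case: (posnP M) => [|M_gt0]; first by lia.
  have dg : in_diagram mu 1 1.
    by apply/and3P; split=> //; apply: part_gt0; rewrite ?size_mu.
  have := lo _ _ dg; rewrite -def_mu hook_diff_add_column1 //.
  by lia.
Qed.

(** * Removing the last step of a path *)

Definition path_state (p p' c : int) (L : nat) (h : seq int) : state :=
  foldl (process_vertex p p' c h) (State [::] 0 0) (iota 1 L).

Definition scoring_step (p p' b' b c : int) : bool :=
  (b' != c) && ~~ even_band p p' (Num.min b c)
  || (b' == c) && even_band p p' (Num.min b c).

Definition hook_index (p p' b c : int) : int :=
  ((p * c) %/ p')%Z + ((b - c + 1) %/ 2)%Z.

(** The removed endpoint [b] becomes the extra height after the end of the shorter path. Hence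
    earlier vertices keep their type, and the induction must let the extra height vary. *)
Lemma height_rcons (b c : int) (h : seq int) (i : nat) :
  (i <= size h)%N -> height c (rcons h b) i = height b h i.
Proof. by rewrite /height [LHS]nth_rcons size_rcons ltnS => ->. Qed.

Lemma scoring_rcons (p p' b c : int) (h : seq int) (i : nat) :
  (i < size h)%N -> scoring p p' c (rcons h b) i = scoring p p' b h i.
Proof.
move=> lt_i; rewrite /scoring /straight /peak /even_vertex.
by rewrite !height_rcons //; lia.
Qed.

Lemma up_step_rcons (b c : int) (h : seq int) (i : nat) :
  (i <= size h)%N -> up_step c (rcons h b) i = up_step b h i.
Proof. by move=> le_i; rewrite /up_step !height_rcons //; lia. Qed.

Section LastVertex.

Variables (L : nat) (h : seq int) (size_h : size h = L.+1).

Lemma height_last (b c : int) : height c (rcons h b) L.+1 = b.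
Proof.
by rewrite height_rcons ?size_h // /height nth_rcons size_h ltnn eqxx.
Qed.

Lemma height_penultimate (b c : int) : height c (rcons h b) L = h`_L.
Proof. by rewrite height_rcons ?size_h // /height nth_rcons size_h ltnSn. Qed.

Lemma scoring_last (p p' b c : int) :
  scoring p p' c (rcons h b) L.+1 = scoring_step p p' h`_L b c.
Proof.
rewrite /scoring /straight /peak /even_vertex /= height_last height_penultimate.
by rewrite /height nth_rcons size_rcons size_h ltnn eqxx.
Qed.

Lemma up_step_last (b c : int) : up_step c (rcons h b) L.+1 = (b == h`_L + 1).
Proof. by rewrite /up_step /= height_last height_penultimate. Qed.

Lemma path_state_rcons (p p' b c : int) :
  path_state p p' c L.+1 (rcons h b) =
  process_vertex p p' c (rcons h b) (path_state p p' b L h) L.+1.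
Proof.
have iotaS : iota 1 L.+1 = rcons (iota 1 L) L.+1.
  by rewrite -[in LHS](addn1 L) iotaD cats1 add1n.
rewrite /path_state iotaS foldl_rcons; congr process_vertex.
have : all (fun i => (i <= L)%N) (iota 1 L).
  by apply/allP => i; rewrite mem_iota; lia.
(* The two processes agree at every index up to [L], so the induction takes any list of such indices
   and any initial state. *)
elim: (iota 1 L) (State _ _ _) => //= i s IHs [mu N M] /andP[le_i /IHs <-].
by rewrite /process_vertex up_step_rcons ?scoring_rcons ?size_h //; lia.
Qed.

Lemma wt_rcons (p p' a b c : int) :
  wt p p' a c L.+1 (rcons h b) =
  wt p p' a b L h + vertex_weight p p' a c (rcons h b) L.+1.
Proof.
rewrite /wt big_nat_recr //=; congr (_ + _); apply: eq_big_nat => i i_le.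
rewrite /vertex_weight /x_coord /y_coord scoring_rcons ?up_step_rcons ?size_h.
by rewrite !height_rcons ?size_h //; lia.
all: lia.
Qed.

End LastVertex.

Lemma paths_rcons (p' a b : int) (L : nat) (h : seq int) :
  1 <= b <= p' - 1 ->
  paths p' a b L.+1 (rcons h b) <->
  paths p' a (b - 1) L h \/ paths p' a (b + 1) L h.
Proof.
move=> b_bound.
have nthE : size h = L.+1 ->
    forall i, (i <= L)%N -> (rcons h b)`_i = h`_i.
  by move=> size_h i le_i; rewrite nth_rcons size_h ltnS le_i.
have lastE : size h = L.+1 -> (rcons h b)`_L.+1 = b.
  by move=> size_h; rewrite nth_rcons size_h ltnn eqxx.
split=> [[]|].
  rewrite size_rcons => -[size_h] bound step h0 _.
  have paths_h b' : h`_L = b' -> paths p' a b' L h.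
    split=> // [i le_i|i lt_i|]; last by rewrite -nthE.
      by rewrite -nthE //; apply: bound; lia.
    by rewrite -!nthE //; [apply: step|]; lia.
  have := step L (ltnSn L); rewrite lastE // nthE // => step_L.
  have [hL|hL] : h`_L = b - 1 \/ h`_L = b + 1 by lia.
    by left; apply: paths_h.
  by right; apply: paths_h.
have extend b' : `|b - b'| = 1 -> paths p' a b' L h ->
    paths p' a b L.+1 (rcons h b).
  move=> b_b' [size_h bound step h0 hL].
  split; rewrite ?size_rcons ?size_h ?lastE ?nthE //.
    move=> i; rewrite leq_eqVlt ltnS => /predU1P[->|le_i]; first by rewrite lastE.
    by rewrite nthE //; apply: bound.
  move=> i; rewrite ltnS leq_eqVlt => /predU1P[->|lt_i].
    by rewrite lastE // nthE // hL.
  by rewrite !nthE //; [apply: step|lia].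
by case; apply: extend; lia.
Qed.

Lemma paths_belast (p' a b : int) (L : nat) (h : seq int) :
  paths p' a b L.+1 h -> exists h', h = rcons h' b.
Proof.
case/lastP: h => [|h' x] [] //; rewrite size_rcons => -[size_h'] _ _ _.
by rewrite nth_rcons size_h' ltnn eqxx => ->; exists h'.
Qed.

(** The counters are the numbers of up and down steps, so the endpoints and [L] determine them. At a
    scoring vertex the inserted column [M] or row [N] is then the coordinate [x_i] or [y_i], and
    weights agree step by step. The equations are doubled to avoid division. *)
Lemma path_state_invariant (p p' a b c : int) (L : nat) (h : seq int) :
  paths p' a b L h ->
  let: State mu N M := path_state p p' c L h in
  [/\ N%:Z + N%:Z = L%:Z - a + b, M%:Z + M%:Z = L%:Z + a - b,
      (size mu <= M)%N & wt p p' a c L h = (sumn mu)%:Z].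
Proof.
elim: L => [|L IHL] in b c h *.
  by move=> [_ _ _ h0 hb]; rewrite /wt big_geq //; split=> //; lia.
move=> ph; have [h' def_h] := paths_belast ph; rewrite {h}def_h in ph *.
have b_bound : 1 <= b <= p' - 1.
  by case: ph => _ bound _ _ hL; rewrite -hL; apply: bound.
have {ph} [ph|ph] := (paths_rcons a L h' b_bound).1 ph;
  case: (ph) => size_h' _ _ _ hL;
  rewrite path_state_rcons // wt_rcons //;
  move: (IHL _ b _ ph);
  case: (path_state _ _ _ _ _) => mu N M [def_N def_M sz ->];
  rewrite /process_vertex /vertex_weight /x_coord /y_coord up_step_last //;
  rewrite height_last // hL.
- rewrite subrK eqxx; case: ifP => _; split=> //; try by lia.
  + by rewrite size_add_column.
  + rewrite sumn_add_column //; have -> : (L.+1%:Z - (b - a) = M%:Z * 2) by lia.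
    by rewrite mulzK //; lia.
- have -> : (b == b + 1 + 1) = false by lia.
  case: ifP => _; split=> //; try by lia.
  + by rewrite /add_row; case: ifP => _ /=; lia.
  + have -> : (L.+1%:Z + (b - a) = N%:Z * 2) by lia.
    by rewrite mulzK // /add_row; case: eqP => [->|_] /=; lia.
Qed.

(** * The index of the last step and scoring vertices *)

Lemma hook_index_up (p p' b : int) :
  hook_index p p' (b - 1) b = ((p * b) %/ p')%Z.
Proof.
by rewrite /hook_index; have -> : b - 1 - b + 1 = 0 by [lia]; rewrite addr0.
Qed.

Lemma hook_index_down (p p' b : int) :
  hook_index p p' (b + 1) b = ((p * b) %/ p')%Z + 1.
Proof. by rewrite /hook_index; have -> : b + 1 - b + 1 = 2 by lia. Qed.

Lemma even_bandE (p p' k : int) :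
  even_band p p' k = (((p * k) %/ p')%Z == ((p * (k + 1)) %/ p')%Z).
Proof. by rewrite /even_band !(mulrC p). Qed.

Section HookIndex.

Variables p p' : int.
Hypotheses (p_gt0 : 0 < p) (lt_pp' : p < p').

Let p'_gt0 : 0 < p'. Proof. exact: lt_trans lt_pp'. Qed.

Lemma floor_succ (k : int) :
  ((p * k) %/ p')%Z <= ((p * (k + 1)) %/ p')%Z <= ((p * k) %/ p')%Z + 1.
Proof.
have := lez_floor (p * k) (lt0r_neq0 p'_gt0).
have := ltz_ceil (p * k) p'_gt0.
set f := (p * k %/ p')%Z => f_gt f_le.
rewrite lez_divRL // -ltzD1 ltz_divLR // mulrDr mulr1.
by move: f_gt; rewrite !mulrDl !mul1r; lia.
Qed.

(** With [K = p'], [i = a] and [N - M = b - a], these four inequalities are the bounds on [alpha]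
    and [beta] that [hook_partitions_split] asks for. The last one amounts to
    [(p' - p) * (p' - b) >= 0]. *)
Lemma floor_bounds (b : int) : 1 <= b <= p' - 1 ->
  [/\ 0 <= ((p * b) %/ p')%Z, ((p * b) %/ p')%Z <= b - 1,
      ((p * b) %/ p')%Z <= p - 1 & p - p' + b <= ((p * b) %/ p')%Z].
Proof.
move=> b_bound; split;
  by rewrite ?lez_divRL ?lerBrDr -?ltzD1 ?ltrD2r ?ltz_divLR //; nia.
Qed.

(** The parity of the band between [b] and [c] tells whether the index of [(b, c)] is the floor at
    [b] or one more, and turning instead of going straight swaps the role of the parity.
    Consequently, for given [b] and [c], exactly one of the two arrivals at [b] scores. *)
Lemma hook_index_scoring (b' b c : int) :
  b' = b - 1 \/ b' = b + 1 -> c = b + 1 \/ c = b - 1 ->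
  hook_index p p' b c =
    ((p * b) %/ p')%Z + (scoring_step p p' b' b c == (b' == b - 1))%:Z.
Proof.
rewrite /scoring_step => b'_def [] ->; rewrite even_bandE.
  have -> : Num.min b (b + 1) = b by lia.
  rewrite /hook_index; have -> : b - (b + 1) + 1 = 0 by lia.
  by have := floor_succ b; rewrite div0z addr0; lia.
have -> : Num.min b (b - 1) = b - 1 by lia.
rewrite /hook_index; have -> : ((b - (b - 1) + 1) %/ 2)%Z = 1 by lia.
by have := floor_succ (b - 1); rewrite subrK; lia.
Qed.

End HookIndex.

(** * Splitting the sets of partitions according to the last step *)

Lemma add_row_inj (N : nat) : injective (add_row N).
Proof. by rewrite /add_row => mu nu; case: eqP => // _ []. Qed.

(* The upper bounds on [alpha] and [beta] make the hook
   conditions at most cells of an added row or column automatic; the remaining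
   one, at the corner, is the extra condition for [alpha = 0] or [beta = 0]
   that the smaller partition satisfies. *)
Lemma hook_partitions_split (K i alpha beta : int) (N M : nat)
    (scoring_up : bool) :
  let up := if scoring_up then add_column M else id in
  let down := if scoring_up then id else add_row N in
  let U := hook_partitions K i (N%:Z - 1) M (alpha + scoring_up%:Z)
             (beta - scoring_up%:Z) in
  let D := hook_partitions K i N (M%:Z - 1) (alpha - (~~ scoring_up)%:Z)
             (beta + (~~ scoring_up)%:Z) in
  (0 < N + M)%N -> 0 < i < K ->
  (~~ scoring_up)%:Z <= alpha < K - i - N%:Z + M%:Z + (~~ scoring_up)%:Z ->
  scoring_up%:Z <= beta < N%:Z - M%:Z + i + scoring_up%:Z ->
  [/\ set_inj U up, set_inj D down,
      forall mu nu, U mu -> D nu -> up mu <> down nu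
    & hook_partitions K i N M alpha beta = up @` U `|` down @` D].
Proof.
case: scoring_up => /= NM_gt0 i_bound a_bound b_bound;
  rewrite ?subr0 ?addr0; split.
- move=> mu nu /set_mem[/andP[_ mu0] _ [sz_mu _] _ _].
  move=> /set_mem[/andP[_ nu0] _ [sz_nu _] _ _] /(congr1 remove_column).
  by rewrite !add_columnK.
- by [].
- move=> mu nu [_ _ [sz_mu _] _ _] [_ _ [sz_nu _] _ _] /(congr1 size).
  by rewrite size_add_column //; lia.
- apply/seteqP; split=> mu.
    move=> /hook_partitions_column_cover[||||D_mu|[nu U_nu ->]]; try by lia.
      by right; exists mu.
    by left; exists nu.
  case=> [[nu U_nu <-]|[nu D_nu <-]].
    by apply: add_column_hook_partitions U_nu; lia.
  by apply: hook_partitions_widen_M D_nu; lia.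
- by [].
- by move=> mu nu _ _ /add_row_inj.
- move=> mu nu [_ [N0 _] [_ le_mu] _ _] _ def_mu.
  (* An added row puts [N] among the parts, against the bound [N - 1] in [U]; [N = 0] is excluded
     because [U] requires [0 <= N - 1]. *)
  have /le_mu : N \in mu.
    by rewrite def_mu /add_row; case: eqP => [|_]; [lia|apply: mem_head].
  by lia.
- apply/seteqP; split=> mu.
    move=> /hook_partitions_row_cover[||||U_mu|[nu D_nu ->]]; try by lia.
      by left; exists mu.
    by right; exists nu.
  case=> [[nu U_nu <-]|[nu D_nu <-]].
    by apply: hook_partitions_widen_N U_nu; lia.
  by apply: add_row_hook_partitions D_nu; lia.
Qed.

(** This is the wall [b = 0]: the condition for [beta = 0] reads [N < mu_1], against the bound on
    the parts. *)
Lemma hook_partitions_beta0 (K i N M alpha : int) :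
  N - M + i = 0 -> hook_partitions K i N M alpha 0 = set0.
Proof.
move=> NM; rewrite -subset0 => mu [pmu [N0 M0] [_ le] _ [_ /(_ erefl)]].
by case: (posnP (part mu 1)) => [->|/mem_part/le]; lia.
Qed.

(** This is the wall [b = p']: the condition for [alpha = 0] asks for a part of index [M + 1]. *)
Lemma hook_partitions_alpha0 (K i N M beta : int) :
  N - M + i = K -> hook_partitions K i N M 0 beta = set0.
Proof.
move=> NM; rewrite -subset0 => mu [pmu [N0 M0] [sz le] _ [/(_ erefl) gt0 _]].
have := gt0 ltac:(lia); have -> : N - K + i + 1 = M + 1 by lia.
by rewrite /part nth_default //; lia.
Qed.

(** * The map on the last step, and the bijection *)

Lemma path_partition_up (p p' a b c : int) (L M : nat) (h : seq int) :
  paths p' a (b - 1) L h -> M%:Z + M%:Z = L.+1%:Z + a - b ->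
  path_partition p p' c L.+1 (rcons h b) =
    (if scoring_step p p' (b - 1) b c then add_column M else id)
      (path_partition p p' b L h).
Proof.
move=> ph M_def; have := path_state_invariant p b ph.
rewrite /path_partition -!/(path_state _ _ _ _ _).
case: (ph) => size_h _ _ _ hL.
rewrite path_state_rcons //.
case: (path_state p p' b L h) => mu N M' [_ M'_def _ _] /=.
have -> : M = M' by lia.
by rewrite up_step_last // scoring_last // hL subrK eqxx; case: ifP.
Qed.

Lemma path_partition_down (p p' a b c : int) (L N : nat) (h : seq int) :
  paths p' a (b + 1) L h -> N%:Z + N%:Z = L.+1%:Z - a + b ->
  path_partition p p' c L.+1 (rcons h b) =
    (if scoring_step p p' (b + 1) b c then add_row N else id)
      (path_partition p p' b L h).
Proof.
move=> ph N_def; have := path_state_invariant p b ph.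
rewrite /path_partition -!/(path_state _ _ _ _ _).
case: (ph) => size_h _ _ _ hL.
rewrite path_state_rcons //.
case: (path_state p p' b L h) => mu N' M [N'_def _ _ _] /=.
have -> : N = N' by lia.
rewrite up_step_last // scoring_last // hL.
by have -> : (b == b + 1 + 1) = false by [lia]; case: ifP.
Qed.

Section Bijection.

Variables p p' a : int.
Hypotheses (p_gt0 : 0 < p) (lt_pp' : p < p') (a_bound : 1 <= a <= p' - 1).

Let target (N M b c : int) : set (seq nat) :=
  hook_partitions p' a N M (p - hook_index p p' b c) (hook_index p p' b c).

Lemma paths_out (b : int) (L : nat) :
  b = 0 \/ b = p' -> paths p' a b L = set0.
Proof.
move=> b_out; rewrite -subset0 => h [_ bound _ _ hL].
by have := bound L (leqnn L); rewrite hL; lia.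
Qed.

Lemma target_out (N M b c : int) : b = 0 \/ b = p' ->
  1 <= c <= p' - 1 -> c = b + 1 \/ c = b - 1 -> N - M = b - a ->
  target N M b c = set0.
Proof.
move=> b_out c_bound c_def NM; rewrite /target.
case: b_out => b_eq.
  have c_eq : c = 0 + 1 by lia.
  have [fl0 fl1 _ _] := floor_bounds p_gt0 lt_pp' c_bound.
  have -> : hook_index p p' b c = 0.
    by rewrite /hook_index b_eq; have -> : 0 - c + 1 = 0 by [lia]; lia.
  by apply: hook_partitions_beta0; lia.
have [_ _ flp fl1] := floor_bounds p_gt0 lt_pp' c_bound.
have -> : hook_index p p' b c = p.
  by rewrite /hook_index; have -> : b - c + 1 = 2 by [lia]; lia.
by rewrite subrr; apply: hook_partitions_alpha0; lia.
Qed.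

Lemma paths_counters (b N M : int) (L : nat) (h : seq int) :
  paths p' a b L h -> N + M = L%:Z -> N - M = b - a -> 0 <= N /\ 0 <= M.
Proof.
move=> ph NM_sum NM_diff; have := path_state_invariant p b ph.
by case: (path_state _ _ _ _ _) => mu n m [n_def m_def _ _]; lia.
Qed.

(** The shorter paths may end on a wall, and [N - 1] or [M - 1] may be negative; so [b] ranges over
    [0..p'] and [N], [M] over all integers. In these extra cases both sets are empty. *)
Lemma path_partition_bij (L : nat) (b c N M : int) :
  0 <= b <= p' -> 1 <= c <= p' - 1 -> c = b + 1 \/ c = b - 1 ->
  N + M = L%:Z -> N - M = b - a ->
  set_bij (paths p' a b L) (target N M b c) (path_partition p p' c L).
Proof.
elim: L => [|L IHL] in b c N M * => b_bound c_bound c_def NM_sum NM_diff.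
  have [b_out|b_in] : (b = 0 \/ b = p') \/ 1 <= b <= p' - 1 by lia.
    by rewrite paths_out // target_out //; apply: set_bij00.
  split.
  - move=> h ph; have [N0 M0] := paths_counters ph NM_sum NM_diff.
    have b_eq : b = a by lia.
    rewrite /path_partition /=.
    apply: nil_hook_partitions; lia.
  - move=> h1 h2 /set_mem[sz1 _ _ h1a _] /set_mem[sz2 _ _ h2a _] _.
    case: h1 sz1 h1a => [|x []] //= _ ->.
    by case: h2 sz2 h2a => [|y []] //= _ ->.
  - move=> mu [pmu [N0 M0] [sz le] _ _].
    have mu_nil : mu = [::] by apply/nilP; rewrite /nilp; lia.
    exists [:: a]; last by rewrite mu_nil.
    by split=> //= [[]//= _|]; lia.
have [b_out|b_in] : (b = 0 \/ b = p') \/ 1 <= b <= p' - 1 by lia.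
  by rewrite paths_out // target_out //; apply: set_bij00.
have [N_neg|N0] := ltrP N 0.
  have -> : paths p' a b L.+1 = set0.
    by rewrite -subset0 => h /paths_counters/(_ NM_sum NM_diff); lia.
  have -> : target N M b c = set0.
    by rewrite -subset0 => mu [_]; lia.
  exact: set_bij00.
have [M_neg|M0] := ltrP M 0.
  have -> : paths p' a b L.+1 = set0.
    by rewrite -subset0 => h /paths_counters/(_ NM_sum NM_diff); lia.
  have -> : target N M b c = set0.
    by rewrite -subset0 => mu [_]; lia.
  exact: set_bij00.
case: N M N0 M0 NM_sum NM_diff => // N [] // M _ _ NM_sum NM_diff.
have [f0 fb fp fp'] := floor_bounds p_gt0 lt_pp' b_in.
have r_up := hook_index_scoring p_gt0 lt_pp' (or_introl erefl) c_def.
have r_down := hook_index_scoring p_gt0 lt_pp' (or_intror erefl) c_def.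
set sc := scoring_step p p' (b - 1) b c in r_up.
(* Both arrivals must yield the same index of [(b, c)]. *)
have sc_down : scoring_step p p' (b + 1) b c = ~~ sc.
  by move: r_down; rewrite r_up; lia.
rewrite eqxx eqb_id in r_up; rewrite /target r_up.
set f := ((p * b) %/ p')%Z in r_up f0 fb fp fp' *.
have bijU : set_bij (paths p' a (b - 1) L)
    (hook_partitions p' a (N%:Z - 1) M (p - f) f) (path_partition p p' b L).
  by rewrite /f -hook_index_up; apply: IHL => //; lia.
have bijD : set_bij (paths p' a (b + 1) L)
    (hook_partitions p' a N (M%:Z - 1) (p - (f + 1)) (f + 1))
    (path_partition p p' b L).
  by rewrite /f -hook_index_down; apply: IHL => //; lia.
have /= := @hook_partitions_split p' a (p - (f + sc%:Z)) (f + sc%:Z) N M sc.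
set up := if sc then _ else _; set down := if sc then _ else _.
(* The parameters of the shorter paths do not depend on [sc]: an up step leads from index [f], a
   down step from [f + 1]. *)
have -> : p - (f + sc%:Z) + sc%:Z = p - f by lia.
have -> : f + sc%:Z - sc%:Z = f by lia.
have -> : p - (f + sc%:Z) - (~~ sc)%:Z = p - (f + 1) by case: (sc); lia.
have -> : f + sc%:Z + (~~ sc)%:Z = f + 1 by case: (sc); lia.
case=> [||||injU injD disj ->]; try by lia.
have upE h : paths p' a (b - 1) L h ->
    path_partition p p' c L.+1 (rcons h b) = up (path_partition p p' b L h).
  by move=> ph; apply: path_partition_up ph _; lia.
have downE h : paths p' a (b + 1) L h ->
    path_partition p p' c L.+1 (rcons h b) = down (path_partition p p' b L h).
  move=> ph; rewrite (path_partition_down p c (N := N) ph) ?sc_down; last lia.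
  by rewrite /down; case: (sc).
have [funU pinjU surjU] := bijU; have [funD pinjD surjD] := bijD.
split.
- move=> h ph; have [h' def_h] := paths_belast ph; rewrite def_h in ph *.
  case: ((paths_rcons a L h' b_in).1 ph) => ph'.
    left; rewrite upE //; exists (path_partition p p' b L h') => //.
    exact: funU.
  right; rewrite downE //; exists (path_partition p p' b L h') => //.
  exact: funD.
- move=> h1 h2 /set_mem ph1 /set_mem ph2.
  have [h1' def_h1] := paths_belast ph1; have [h2' def_h2] := paths_belast ph2.
  rewrite def_h1 in ph1 *; rewrite def_h2 in ph2 *.
  case: ((paths_rcons a L h1' b_in).1 ph1) => ph1';
    case: ((paths_rcons a L h2' b_in).1 ph2) => ph2';
    rewrite ?(upE _ ph1') ?(upE _ ph2') ?(downE _ ph1') ?(downE _ ph2').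
  + move=> /injU E; congr rcons; apply: pinjU; rewrite ?inE //.
    by apply: E; apply/mem_set/funU.
  (* Paths with different last steps are separated by the disjointness of the two images. *)
  + by move/disj; case; [apply: funU|apply: funD].
  + by move/esym/disj; case; [apply: funU|apply: funD].
  + move=> /injD E; congr rcons; apply: pinjD; rewrite ?inE //.
    by apply: E; apply/mem_set/funD.
- move=> mu [] [nu].
    move=> /surjU[h ph <-] <-; exists (rcons h b); last exact: upE.
    exact: (paths_rcons a L h b_in).2 (or_introl ph).
  move=> /surjD[h ph <-] <-; exists (rcons h b); last exact: downE.
  exact: (paths_rcons a L h b_in).2 (or_intror ph).
Qed.

End Bijection.

Theorem mainTheorem1 (p p' a b c : int) (L : nat)
    (coprime_pp' : coprimez p p') (p_gt0 : 0 < p) (lt_pp' : p < p')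
    (a_bound : 1 <= a <= p' - 1) (b_bound : 1 <= b <= p' - 1)
    (c_bound : 1 <= c <= p' - 1) (c_def : c = b + 1 \/ c = b - 1)
    (L_even : (2 %| L%:Z + a - b)%Z) :
  let N : int := ((L%:Z - a + b) %/ 2)%Z in
  let M : int := ((L%:Z + a - b) %/ 2)%Z in
  let r : int := ((p * c) %/ p')%Z + ((b - c + 1) %/ 2)%Z in
  set_bij (paths p' a b L) (hook_partitions p' a N M (p - r) r)
          (path_partition p p' c L)
  /\ forall h : seq int, paths p' a b L h ->
       wt p p' a c L h = (sumn (path_partition p p' c L h))%:Z.
Proof.
move=> N M r; split=> [|h ph].
  apply: (path_partition_bij p_gt0 lt_pp' a_bound) => //; rewrite /N /M; lia.
have := path_state_invariant p c ph; rewrite /path_partition /path_state.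
by case: (foldl _ _ _) => mu n m [].
Qed.
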